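(* Let $n \geq 1$ be an integer, let $X_0,\dots,X_{n-1}$ be nontrivial strictly convex Banach spaces, and let $Z = \bigoplus_{i=0}^{n-1} X_i$ be their direct sum equipped with the norm $\|(x_0,\dots,x_{n-1})\| = \max_{0\le i<n} \|x_i\|$. Let $B_Z$ and $S_Z$ be the closed unit ball and unit sphere of $Z$. Let $f\colon B_Z \to B_Z$ be a 1-Lipschitz bijection. If $f$ maps every extreme point of $B_Z$ to an extreme point of $B_Z$, or if $f(S_Z) \subseteq S_Z$, then $f$ is an isometry.
   Context: A Banach space is strictly convex if its unit sphere contains no line segment with distinct endpoints. Nontrivial means different from $\{0\}$. The map $f$ is 1-Lipschitz if $\|f(x)-f(y)\|\le\|x-y\|$ for all $x,y \in B_Z$. *)

(* Defs.v *)
From HB Require Import structures.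
From mathcomp Require Import all_boot all_order all_algebra.
From mathcomp Require Import all_classical all_reals all_analysis.

Set Implicit Arguments.
Unset Strict Implicit.
Unset Printing Implicit Defensive.

Import Order.TTheory GRing.Theory Num.Theory.
Import numFieldNormedType.Exports.

Local Open Scope classical_set_scope.
Local Open Scope ring_scope.

(* The direct sum of the [X i], equipped below with pointwise operations and
   the norm max_i `|x i|.  The base value 0 of the big max is harmless as norms
   are nonnegative. *)
Definition max_sum (R : realType) (n : nat) (X : 'I_n -> completeNormedModType R) : Type :=
  forall i : 'I_n, X i.

Section max_sum.
Variables (R : realType) (n : nat) (X : 'I_n -> completeNormedModType R).
Local Notation Z := (max_sum X).
Implicit Types x y z : Z.

HB.instance Definition _ := gen_eqMixin Z.
HB.instance Definition _ := gen_choiceMixin Z.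

Definition max_sum_zero : Z := fun=> 0.
Definition max_sum_add x y : Z := fun i => x i + y i.
Definition max_sum_opp x : Z := fun i => - x i.
Definition max_sum_scale (a : R) x : Z := fun i => a *: x i.
Definition max_sum_norm x : R := \big[Num.max/0]_(i < n) `|x i|.

Fact max_sum_addA : associative max_sum_add.
Proof. by move=> x y z; apply: functional_extensionality_dep => i; exact: addrA. Qed.
Fact max_sum_addC : commutative max_sum_add.
Proof. by move=> x y; apply: functional_extensionality_dep => i; exact: addrC. Qed.
Fact max_sum_add0 : left_id max_sum_zero max_sum_add.
Proof. by move=> x; apply: functional_extensionality_dep => i; exact: add0r. Qed.
Fact max_sum_addN : left_inverse max_sum_zero max_sum_opp max_sum_add.
Proof. by move=> x; apply: functional_extensionality_dep => i; exact: addNr. Qed.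

HB.instance Definition _ := GRing.isZmodule.Build Z
  max_sum_addA max_sum_addC max_sum_add0 max_sum_addN.

Fact max_sum_scaleA a b x :
  max_sum_scale a (max_sum_scale b x) = max_sum_scale (a * b) x.
Proof. by apply: functional_extensionality_dep => i; exact: scalerA. Qed.
Fact max_sum_scale1 : left_id 1 max_sum_scale.
Proof. by move=> x; apply: functional_extensionality_dep => i; exact: scale1r. Qed.
Fact max_sum_scaleDr : right_distributive max_sum_scale +%R.
Proof. by move=> a x y; apply: functional_extensionality_dep => i; exact: scalerDr. Qed.
Fact max_sum_scaleDl x :
  {morph max_sum_scale^~ x : a b / a + b}.
Proof. by move=> a b; apply: functional_extensionality_dep => i; exact: scalerDl. Qed.

HB.instance Definition _ := GRing.Zmodule_isLmodule.Build R Z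
  max_sum_scaleA max_sum_scale1 max_sum_scaleDr max_sum_scaleDl.

Fact max_sum_norm_ge x i : `|x i| <= max_sum_norm x.
Proof. exact: (le_bigmax_cond _ (fun i => `|x i|)). Qed.

Fact max_sum_normD x y :
  max_sum_norm (x + y) <= max_sum_norm x + max_sum_norm y.
Proof.
have ge0 z : 0 <= max_sum_norm z by apply: bigmax_ge_id.
apply: bigmax_le => [|i _]; first exact: addr_ge0.
by apply: (le_trans (ler_normD _ _)); apply: lerD; exact: max_sum_norm_ge.
Qed.

Fact max_sum_normZ (a : R) x :
  max_sum_norm (a *: x) = `|a| * max_sum_norm x.
Proof.
rewrite /max_sum_norm (big_morph ( *%R `|a|) (id1 := 0) (op1 := Num.max)).
- by apply: eq_bigr => i _; exact: normrZ.
- by move=> u v; rewrite maxr_pMr.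
- exact: mulr0.
Qed.

Fact max_sum_norm0_eq0 x : max_sum_norm x = 0 -> x = 0.
Proof.
move=> x0; apply: functional_extensionality_dep => i.
by apply/eqP; rewrite -normr_le0 -x0; exact: max_sum_norm_ge.
Qed.

HB.instance Definition _ := Lmodule_isNormed.Build R Z
  max_sum_normD max_sum_normZ max_sum_norm0_eq0.

Fact max_sum_cauchy_cvg (F : set_system Z) :
  ProperFilter F -> cauchy F -> cvg F.
Proof.
move=> FF /cauchyP Fc.
have Fi i : cvg ((fun x : Z => x i) @ F).
  apply: cauchy_cvg; apply/cauchyP => e e0.
  have [z Fz] := Fc _ e0; exists (z i).
  apply: (@filterS _ F _ (ball z e)) Fz => x /=; rewrite -!ball_normE /=.
  by apply: le_lt_trans; exact: (max_sum_norm_ge (z - x)).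
pose l : Z := fun i => lim ((fun x : Z => x i) @ F).
apply/cvg_ex; exists l; apply/cvgrPdist_lt => e e0.
have : \forall x \near F, forall i, `|l i - x i| < e.
  apply: filter_forall => i.
  by move/cvgrPdist_lt : (Fi i); apply.
apply: filterS => x lx.
by apply: bigmax_lt => // i _; exact: lx.
Qed.

HB.instance Definition _ := Uniform_isComplete.Build Z max_sum_cauchy_cvg.

End max_sum.

Definition unit_sphere (R : realType) (V : normedModType R) : set V :=
  [set x | `|x| = 1].
Arguments unit_sphere {R} V.

Definition segment (R : realType) (V : lmodType R) (x y : V) : set V :=
  [set (1 - t) *: x + t *: y | t in `[0, 1]%classic].

Definition open_segment (R : realType) (V : lmodType R) (x y : V) : set V :=
  [set (1 - t) *: x + t *: y | t in `]0, 1[%classic].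

Definition strictly_convex (R : realType) (V : normedModType R) : Prop :=
  ~ exists x y : V, x != y /\ segment x y `<=` unit_sphere V.

Definition extreme_point (R : realType) (V : lmodType R) (C : set V) : set V :=
  [set x | C x /\
    forall y z, C y -> C z -> open_segment y z x -> y = x /\ z = x].

Definition isometry_on (R : realType) (V W : normedModType R) (A : set V)
    (f : V -> W) : Prop :=
  {in A &, forall x y, `|f x - f y| = `|x - y|}.

(* Main.v *)
Require Import Defs.
From mathcomp Require Import all_boot all_order all_algebra.
From mathcomp Require Import all_classical all_reals all_analysis.
From mathcomp Require Import ring lra.
Set Implicit Arguments.
Unset Strict Implicit.
Unset Printing Implicit Defensive.
Import Order.TTheory GRing.Theory Num.Theory.
Import numFieldNormedType.Exports.
Local Open Scope classical_set_scope.
Local Open Scope ring_scope.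

(** Let G be the inverse of f; it does not decrease distances.  The proof shows
    that, up to a permutation of the summands, G is a product of maps
    X_j -> X_(p j) that commute with scalars and preserve norms, and then that
    such a nonexpansive f is an isometry.

    Coordinates.  By strict convexity two points of the unit ball of Z at
    distance 2 are [opposed]: some coordinate of one is a unit vector and the
    same coordinate of the other is its negative.  Let u have all coordinates of
    norm 1.  Its 2^n sign changes [flip A u] are pairwise opposed, hence so are
    their images under G.  Choose one vector out of every antipodal pair in each
    X_i: a point of Z becomes a vector of n bits, and opposed points get
    different bits.  So 2^n pairwise opposed points use every bit vector exactly
    once ([opposed_family_bits_onto]), whatever the choice was.  It follows that
    the coordinates of G u have norm 1, and, by comparing with G w for a point w
    inside the segment from u to its j-th sign change, that changing one sign in
    u changes exactly one sign in G u ([opposed_family_neighbours]).  So G acts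
    on the sign changes of u as an automorphism of the n-cube that permutes the
    n directions, and opposition then forces G w (p j) = h_j (w j) for every w
    in the ball with w j of norm 1, where p and the odd injections h_j depend on
    G only ([expansive_unit_coords]).

    Radial form.  Extend h_j to X_j by positive homogeneity.  If the values of f
    at the two points obtained from x by moving its coordinate p j to h_j a and
    to - h_j a are the expected ones, then strict convexity pins down f at the
    points between them ([between_image]).  If f preserves the unit sphere, the
    expected values are obtained by shrinking the other coordinates, so that
    only one coordinate is left to witness that the norm is 1
    ([sphere_unit_coord]).  If f preserves extreme points, which are the points
    with all coordinates of norm 1, then the h_j are onto, and an induction on
    the number of coordinates of w of norm less than 1 gives the formula for
    G w ([radial_of_extreme]).

    Isometry.  Now f is nonexpansive, preserves norms and commutes with the
    scalars in [-1, 1].  Such a map F preserves distances: where the norm is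
    differentiable along the line x - s y, the estimates of F z + h F y and
    F z - h F x at z = x - s y for small h force
    |F x - s F y| >= |x - s y|, and convexity gives enough such s near 1
    ([isometry_of_homogeneous]). *)

(** * Norm-preserving homogeneous nonexpansive maps *)

Lemma norm_line_le (R : realType) (V : normedModType R) (x y : V) (a b : R) :
  `|x - a *: y| <= `|x - b *: y| + `|b - a| * `|y|.
Proof.
have -> : x - a *: y = x - b *: y + (b - a) *: y.
  by rewrite scalerBl addrA subrK.
by rewrite (le_trans (ler_normD _ _))// normrZ.
Qed.

(** Three vectors that F controls, namely F (x - s y) shifted by multiples of
    F x, of F y and of F x - s F y, add up to a multiple of F (x - s y).  The
    first two shifts are bounded through nonexpansiveness, so the triangle
    inequality bounds |F x - s F y| from below, up to the second difference of
    the norm along the line x - s y. *)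
Lemma second_difference_ge (R : realType) (V W : normedModType R) (F : V -> W)
    (x y : V) (s k : R) :
  (forall z, `|z| <= 1 -> `|F z| = `|z|) ->
  (forall (t : R) z, `|t| <= 1 -> `|z| <= 1 -> F (t *: z) = t *: F z) ->
  (forall z1 z2, `|z1| <= 1 -> `|z2| <= 1 -> `|F z1 - F z2| <= `|z1 - z2|) ->
  4 * `|x| <= 1 -> 4 * `|y| <= 1 -> 1 <= s <= 2 -> 0 < k <= 1 ->
  k * (`|x - s *: y| - `|F x - s *: F y|) <=
  s * (`|x - (s + k) *: y| + `|x - (s - k) *: y| - 2 * `|x - s *: y|).
Proof.
move=> Fn Fh Fl x4 y4 /andP[s1 s2] /andP[k0 k1].
have x1 : `|x| <= 1 by have := normr_ge0 x; lra.
have y1 : `|y| <= 1 by have := normr_ge0 y; lra.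
set z := x - s *: y.
have s0 : 0 <= s by lra.
have k0' : 0 <= k by lra.
have sk0 : 0 < s + k by lra.
have z1 : `|z| <= 1.
  rewrite (le_trans (ler_normB _ _))// normrZ (ger0_norm s0).
  have : s * `|y| <= 2 * `|y| by rewrite ler_wpM2r.
  by lra.
have k1' : `|- k| <= 1 by rewrite normrN ger0_norm.
have h1 : `|k / (s + k)| <= 1.
  rewrite ger0_norm ?divr_ge0 ?ler_pdivrMr// ?mul1r; lra.
have norm1 t (a : V) : `|t| <= 1 -> `|a| <= 1 -> `|t *: a| <= 1.
  by move=> t1 a1; rewrite normrZ mulr_ile1.
have ky : `|F z + k *: F y| <= `|x - (s - k) *: y|.
  have := Fl z (- k *: y) z1 (norm1 _ _ k1' y1).
  by rewrite Fh// !scaleNr !opprK /z scalerBl opprB addrA addrAC.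
have hx : `|(s + k) *: F z - k *: F x| <= s * `|x - (s + k) *: y|.
  have := Fl z ((k / (s + k)) *: x) z1 (norm1 _ _ h1 x1).
  rewrite Fh// => /(ler_wpM2l (ltW sk0)).
  have scale c (a : V) : 0 <= c -> c * `|a| = `|c *: a|.
    by move=> c0; rewrite normrZ ger0_norm.
  have scale' c (a : W) : 0 <= c -> c * `|a| = `|c *: a|.
    by move=> c0; rewrite normrZ ger0_norm.
  rewrite scale ?scale' ?(ltW sk0)// scale// !scalerBr !scalerA.
  rewrite mulrCA divff ?mulr1 ?gt_eqF// => /le_trans; apply.
  rewrite [(s + k) * s]mulrC [(s + k) *: x]scalerDl addrAC.
  rewrite -[_ + _ - k *: x]addrA subrr addr0.
  by [].
have : (3 * s + k) *: F z = (s *: F z + k *: (F x - s *: F y))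
       + ((s + k) *: F z - k *: F x) + s *: (F z + k *: F y).
  rewrite scalerBr scalerDr !scalerA [k * s]mulrC !scalerDl.
  have -> : (3 * s) *: F z = s *: F z + s *: F z + s *: F z.
    by rewrite -!scalerDl; congr (_ *: _); ring.
  set A := s *: F z; set B := k *: F z; set C := k *: F x.
  set D := (s * k) *: F y.
  rewrite (addrACA A (C - D)) [C - D + _]addrAC subrr add0r addrACA addNr addr0.
  by rewrite addrAC !addrA.
move=> /(congr1 Num.norm); rewrite normrZ ger0_norm; last lra.
rewrite (Fn _ z1) => e.
have n1 := ler_normD (s *: F z) (k *: (F x - s *: F y)).
have n2 := ler_normD (s *: F z + k *: (F x - s *: F y)) ((s + k) *: F z - k *: F x).
have := ler_normD ((s *: F z + k *: (F x - s *: F y))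
       + ((s + k) *: F z - k *: F x)) (s *: (F z + k *: F y)).
rewrite -e; move: n1 n2; rewrite !normrZ !(ger0_norm s0) !(ger0_norm k0') !(Fn _ z1).
have := ler_wpM2l s0 ky.
move: hx.
set a := `|x - _|; set b := `|x - _|.
set a' := `|_ - _|; set b' := `|F z + _|; set c := `|F x - _|.
set d := `|s *: F z + _|; set d' := `|s *: F z + _ + _|; set N := `|z|.
lra.
Qed.

(** Second differences of a convex Lipschitz function telescope: over m + 1
    consecutive steps of length k their sum is O(k).  Averaging
    [second_difference_ge] over these steps leaves a defect O(1/m) when
    k = (m + 1)^-2, which also keeps s within O(1/m) of 1. *)
Lemma isometry_of_homogeneous (R : realType) (V W : normedModType R) (F : V -> W) :
  (forall z, `|z| <= 1 -> `|F z| = `|z|) ->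
  (forall (t : R) z, `|t| <= 1 -> `|z| <= 1 -> F (t *: z) = t *: F z) ->
  (forall z1 z2, `|z1| <= 1 -> `|z2| <= 1 -> `|F z1 - F z2| <= `|z1 - z2|) ->
  forall x y, `|x| <= 1 -> `|y| <= 1 -> `|F x - F y| = `|x - y|.
Proof.
move=> Fn Fh Fl x0 y0 x01 y01; apply/eqP; rewrite eq_le Fl//=.
have q1 : `|4^-1 : R| <= 1 by rewrite ger0_norm; lra.
(* Scaling by 1/4 keeps x - s y in the unit ball for s <= 2. *)
rewrite -(ler_pM2l (_ : 0 < 4^-1 :> R)); last lra.
have q0 : 0 <= 4^-1 :> R by lra.
rewrite -{1 2}(ger0_norm q0) -!normrZ !scalerBr -!Fh//.
have {x01} : 4 * `|4^-1 *: x0| <= 1 by rewrite normrZ (ger0_norm q0); lra.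
have {y01} : 4 * `|4^-1 *: y0| <= 1 by rewrite normrZ (ger0_norm q0); lra.
move: (4^-1 *: x0) (4^-1 *: y0) => {x0 y0 q1 q0} x y y4 x4.
have y1 : `|y| <= 1 by have := normr_ge0 y; lra.
rewrite -subr_le0; set d := _ - _.
suff Hm m : d * m.+1%:R <= 6.
  rewrite leNgt; apply/negP => d0.
  have /archi_boundP := divr_ge0 (ler0n R 6) (ltW d0).
  rewrite ltr_pdivrMr// ltNge => /negP; apply; rewrite mulrC.
  by rewrite (le_trans _ (Hm (Num.bound (6 / d))))// ler_pM2l// ler_nat.
set M : R := m.+1%:R; have M1 : 1 <= M by rewrite ler1n.
set k := M ^- 2.
have kM : k * M * M = 1 by rewrite -mulrA -expr2 mulVf// expf_neq0// gt_eqF; lra.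
have k0 : 0 < k by rewrite invr_gt0 exprn_gt0; lra.
have k1 : k <= 1 by rewrite invf_le1 ?exprn_ege1 ?exprn_gt0; lra.
pose N (j : nat) := `|x - (1 + k * j%:R) *: y|.
have Nlip j i : N j <= N i + k * `|j%:R - i%:R|.
  rewrite (le_trans (norm_line_le _ _ _ (1 + k * i%:R)))// lerD2l.
  have -> : 1 + k * i%:R - (1 + k * j%:R) = k * (i%:R - j%:R) by ring.
  by rewrite normrM (gtr0_norm k0) -mulrA [`|i%:R - _|]distrC ler_pM2l// ler_piMr.
pose D j := N j.+1 - N j.
have step j : (j <= m)%N ->
    k * d <= 2 * (D j.+1 - D j) + 2 * k * (k * M).
  move=> jm; have jM : j.+1%:R <= M by rewrite ler_nat.
  have kj : k * j.+1%:R <= k * M by rewrite ler_pM2l.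
  have kj0 : 0 <= k * j.+1%:R by rewrite mulr_ge0// ltW.
  have kM1 : k * M <= 1.
    by rewrite -kM ler_peMr// mulr_ge0; lra.
  have : 1 <= 1 + k * j.+1%:R <= 2 by apply/andP; split; lra.
  have : 0 < k <= 1 by rewrite k0.
  move/(second_difference_ge Fn Fh Fl x4 y4)/[apply].
  have -> : 1 + k * j.+1%:R + k = 1 + k * j.+2%:R by rewrite -natr1; ring.
  have -> : 1 + k * j.+1%:R - k = 1 + k * j%:R by rewrite -natr1; ring.
  rewrite -/(N j.+1) -/(N j.+2) -/(N j).
  have H1 : `|x - y| <= N j.+1 + k * M.
    have := norm_line_le x y 1 (1 + k * j.+1%:R).
    rewrite scale1r addrAC subrr add0r (ger0_norm kj0) => /le_trans; apply.
    by rewrite lerD2l (le_trans _ kj)// ler_piMr.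
  have H2 : `|F x - (1 + k * j.+1%:R) *: F y| <= `|F x - F y| + k * M.
    have := norm_line_le (F x) (F y) (1 + k * j.+1%:R) 1.
    rewrite scale1r opprD addrA subrr add0r normrN (ger0_norm kj0) => /le_trans.
    by apply; rewrite lerD2l (le_trans _ kj)// ler_piMr// Fn.
  have H3 : 2 * N j.+1 <= N j.+2 + N j.
    rewrite -[2]ger0_norm// -normrZ (le_trans _ (ler_normD _ _))// le_eqVlt.
    apply/orP; left; apply/eqP; congr (`|_|).
    rewrite scalerBr scalerA addrACA -opprD -scalerDl scaler_nat mulr2n.
    by congr (_ - _ *: _); rewrite -natr1; ring.
  have H4 : k * d <= k * (N j.+1 - `|F x - (1 + k * j.+1%:R) *: F y| + 2 * (k * M)).
    by rewrite ler_pM2l// /d; lra.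
  move=> H5; apply: (le_trans H4); move: H5.
  set a := `|F x - _ *: _|; set c := N j.+1; set c' := N j.+2; set c'' := N j.
  rewrite -/c -/c' -/c'' in H3.
  have : k * j.+1%:R * (c' + c'' - 2 * c) <= 1 * (c' + c'' - 2 * c).
    by rewrite ler_wpM2r//; lra.
  rewrite /D -/c -/c' -/c''; lra.
have : \sum_(0 <= j < m.+1) (k * d) <=
    \sum_(0 <= j < m.+1) (2 * (D j.+1 - D j) + 2 * k * (k * M)).
  by rewrite big_nat [leRHS]big_nat; apply: ler_sum => j /andP[_ jm]; apply: step.
rewrite big_split/= -[X in _ <= X + _]mulr_sumr telescope_sumr//.
rewrite !sumr_const_nat subn0 -[leLHS]mulr_natr
  -[X in _ <= _ + X]mulr_natr -/M.
have := Nlip m.+2 m.+1; have := Nlip 0%N 1%N.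
have e1 : `|m.+2%:R - m.+1%:R| = 1 :> R by rewrite -natrB// subSnn normr1.
have e2 : `|0%:R - 1%:R| = 1 :> R by rewrite sub0r normrN1.
rewrite e1 e2 /D => H1 H2 H3.
rewrite -(ler_pM2l k0) mulrA; apply: (le_trans H3).
have -> : 2 * k * (k * M) * M = 2 * k * (k * M * M) by ring.
rewrite kM; clear -H1 H2; lra.
Qed.

(** * Strict convexity *)

Section strict_convexity.
Variables (R : realType) (V : normedModType R).
Hypothesis V_strictly_convex : strictly_convex V.
Implicit Types (u v x y a p : V) (l t : R).

Lemma strictly_convex_eq u v l : `|u| <= 1 -> `|v| <= 1 -> 0 < l < 1 ->
  `|(1 - l) *: u + l *: v| = 1 -> u = v.
Proof.
move=> u1 v1 /andP[l0 l1] uv1; apply/eqP; apply: contrapT => /negP uv.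
apply: V_strictly_convex; exists u, v; split => // _ [t + <-].
rewrite /= in_itv/= => /andP[t0 t1]; apply/eqP.
have nle (b : R) (w : V) : 0 <= b -> `|w| <= 1 -> `|b *: w| <= b.
  by move=> b0 w1; rewrite normrZ (ger0_norm b0) ler_piMr.
rewrite /= eq_le; apply/andP; split.
  rewrite (le_trans (ler_normD _ _))//.
  have := @nle (1 - t) u; have := @nle t v t0 v1; lra.
have [tl|lt] := leP t l.
- have t1' : 0 < 1 - t by lra.
  pose b := (1 - l) / (1 - t).
  have b0 : 0 < b by rewrite divr_gt0//; lra.
  have b1 : b <= 1 by rewrite ler_pdivrMr//; lra.
  have bt : b * (1 - t) = 1 - l by rewrite divfK// gt_eqF.
  have e : (1 - l) *: u + l *: v = b *: ((1 - t) *: u + t *: v) + (1 - b) *: v.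
    rewrite scalerDr !scalerA bt -addrA -scalerDl; congr (_ + _ *: _); lra.
  rewrite -(ler_pM2l b0) mulr1.
  have := ler_normD (b *: ((1 - t) *: u + t *: v)) ((1 - b) *: v).
  rewrite -e uv1 normrZ (gtr0_norm b0).
  have : `|(1 - b) *: v| <= 1 - b by apply: nle => //; lra.
  lra.
- have t0' : 0 < t by lra.
  pose b := l / t.
  have b0 : 0 < b by rewrite divr_gt0//; lra.
  have b1 : b <= 1 by rewrite ler_pdivrMr//; lra.
  have bt : b * t = l by rewrite divfK// gt_eqF.
  have e : (1 - l) *: u + l *: v = (1 - b) *: u + b *: ((1 - t) *: u + t *: v).
    rewrite scalerDr !scalerA bt addrA -scalerDl; congr (_ *: _ + _).
    rewrite -[in LHS]bt; ring.
  rewrite -(ler_pM2l b0) mulr1.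
  have := ler_normD ((1 - b) *: u) (b *: ((1 - t) *: u + t *: v)).
  rewrite -e uv1 [X in _ + X]normrZ (gtr0_norm b0).
  have : `|(1 - b) *: u| <= 1 - b by apply: nle => //; lra.
  lra.
Qed.

Lemma antipodal_of_dist2 x y : `|x| <= 1 -> `|y| <= 1 -> 2 <= `|x - y| ->
  `|x| = 1 /\ y = - x.
Proof.
move=> x1 y1 xy2.
have xy : x = - y.
  apply: (@strictly_convex_eq _ _ 2^-1) => //; rewrite ?normrN//; first lra.
  have -> : 1 - 2^-1 = 2^-1 :> R by lra.
  rewrite -scalerDr normrZ ger0_norm ?invr_ge0//.
  have := ler_normB x y; lra.
split; last by rewrite xy opprK.
by have := ler_normB x y; lra.
Qed.

(** If t < 1, the unit vector a is the combination of (a - p) / (1 - t) and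
    (a + p) / (1 + t) with weights (1 - t) / 2 and (1 + t) / 2; both lie in the
    ball, so both are equal to a. *)
Lemma between_antipodes a p t : `|a| = 1 -> 0 <= t <= 1 ->
  `|p - a| <= 1 - t -> `|p + a| <= 1 + t -> p = t *: a.
Proof.
move=> a1 /andP[t0 t1] pa pa'.
have [t1'|t1'] := eqVneq t 1.
  apply/eqP; rewrite t1' scale1r -subr_eq0 -normr_le0; lra.
have tn : 0 < 1 - t by rewrite subr_gt0 lt_neqAle t1'.
have tp : 0 < 1 + t by lra.
pose u := (1 - t)^-1 *: (a - p); pose v := (1 + t)^-1 *: (a + p).
have uE : (1 - t) *: u = a - p by rewrite /u scalerA divff ?scale1r// gt_eqF.
have vE : (1 + t) *: v = a + p by rewrite /v scalerA divff ?scale1r// gt_eqF.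
pose l := (1 + t) / 2.
have mid : (1 - l) *: u + l *: v = a.
  have -> : 1 - l = 2^-1 * (1 - t) by rewrite /l; lra.
  rewrite /l [(1 + t) / 2]mulrC -!scalerA uE vE -scalerDr addrACA addNr addr0 -mulr2n.
  by rewrite -[a *+ 2]scaler_nat scalerA mulVf ?scale1r.
have uv : u = v.
  apply: (@strictly_convex_eq _ _ l).
  - by rewrite normrZ gtr0_norm ?invr_gt0// mulrC ler_pdivrMr// mul1r distrC.
  - by rewrite normrZ gtr0_norm ?invr_gt0// mulrC ler_pdivrMr// mul1r addrC.
  - by rewrite /l; lra.
  - by rewrite mid.
have : a = v by rewrite -mid uv -scalerDl subrK scale1r.
by move=> av; move: vE; rewrite -av scalerDl scale1r => /addrI.
Qed.

End strict_convexity.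

(** * Signs, and families of pairwise opposed points *)

Section signs.
Variables (R : realType) (V : normedModType R).
Implicit Types (a b c : V) (s : V -> bool).

Lemma unit_vector : (exists x : V, x != 0) -> exists a, `|a| = 1.
Proof.
move=> [x x0]; exists (`|x|^-1 *: x).
by rewrite normrZ normfV normr_id mulVf// normr_eq0.
Qed.

Lemma unit_neqN a : `|a| = 1 -> (a == - a) = false.
Proof.
move=> a1; apply/negP => /eqP aN.
have : 2 *: a == 0 by rewrite scaler_nat mulr2n {2}aN subrr.
rewrite scaler_eq0 pnatr_eq0/= => /eqP a0.
by move: a1; rewrite a0 normr0 => /eqP; rewrite eq_sym oner_eq0.
Qed.

(** A choice of one vector out of each antipodal pair of the unit sphere; the
    values off the sphere are arbitrary. *)
Definition odd_sign s := forall a, `|a| = 1 -> s (- a) = ~~ s a.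

Lemma odd_sign_exists : exists s, odd_sign s.
Proof.
pose r a := choose (pred2 a (- a)) a.
have rN a : r (- a) = r a.
  rewrite /r (@eq_choose _ _ (pred2 a (- a))); last first.
    by move=> b; rewrite /= opprK orbC.
  by apply: choose_id; rewrite /= eqxx ?orbT.
exists (fun a => r a == a) => a a1; rewrite rN.
have /pred2P[->|->] : pred2 a (- a) (r a) by apply: chooseP; rewrite /= eqxx.
  by rewrite unit_neqN// eqxx.
by rewrite eqxx eq_sym unit_neqN.
Qed.

(** Unless a = - b, the pairs {a, -a} and {b, -b} are disjoint, and the choice
    in the first one is free. *)
Lemma odd_sign_separates a b : `|b| = 1 -> a != b ->
  exists2 s, odd_sign s & s a != s b.
Proof.
move=> b1 ab; have [s s_odd] := odd_sign_exists.
have [->|aNb] := eqVneq a (- b).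
  by exists s; rewrite // s_odd//; case: (s b).
exists (fun c => if c == a then ~~ s b else if c == - a then s b else s c).
  move=> c c1; rewrite (eqr_oppLR c a) eqr_opp; have := unit_neqN c1.
  case: (eqVneq c a) => [->|_]; first by move=> ->; rewrite negbK.
  by case: (eqVneq c (- a)) => // _ _; rewrite s_odd.
rewrite eqxx [b == a]eq_sym (negbTE ab) if_same.
by case: (s b).
Qed.

End signs.

Section max_sum_theory.
Variables (R : realType) (n : nat) (X : 'I_n -> completeNormedModType R).
Local Notation Z := (max_sum X).
Implicit Types (x y z u v w : Z) (A B C D : {set 'I_n}) (i j k l : 'I_n).

Lemma inj_surj (p : 'I_n -> 'I_n) : injective p -> forall k, exists j, k = p j.
Proof. by move=> p_inj k; have /codomP[j ->] := injF_onto p_inj k; exists j. Qed.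

Lemma max_sum_ext x y : (forall i, x i = y i) -> x = y.
Proof. exact: functional_extensionality_dep. Qed.

Lemma coord_norm_le x i : `|x i| <= `|x|.
Proof. exact: max_sum_norm_ge. Qed.

Lemma max_sum_norm_le x (r : R) : 0 <= r -> (forall i, `|x i| <= r) -> `|x| <= r.
Proof. by move=> r0 xr; apply: bigmax_le => // i _; apply: xr. Qed.

Lemma max_sum_norm_attained x : 0 < `|x| -> exists i, `|x i| = `|x|.
Proof.
move=> x0; apply: contrapT => xi.
suff : `|x| < `|x| by rewrite ltxx.
apply: bigmax_lt => // i _; rewrite lt_neqAle coord_norm_le andbT.
by apply/eqP => xx; apply: xi; exists i.
Qed.

Definition unit_coords u := forall i, `|u i| = 1.

Lemma unit_coords_ball u : unit_coords u -> `|u| <= 1.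
Proof. by move=> u1; apply: max_sum_norm_le => // i; rewrite u1. Qed.

Lemma unit_coords_exists : (forall i, exists x : X i, x != 0) ->
  exists u, unit_coords u.
Proof.
move=> X_nontrivial.
by exists (fun i => projT1 (cid (unit_vector (X_nontrivial i)))) => i; case: cid.
Qed.

Lemma update_ball x i (b : X i) : `|x| <= 1 -> `|b| <= 1 ->
  `|eqtype.dfwith x b : Z| <= 1.
Proof.
move=> x1 b1; apply: max_sum_norm_le => // k.
have [<-|ik] := eqVneq i k; first by rewrite dfwith_in.
by rewrite dfwith_out// (le_trans (coord_norm_le _ _)).
Qed.

Definition flip A x : Z := fun i => if i \in A then - x i else x i.

Lemma unit_coords_flip A u : unit_coords u -> unit_coords (flip A u).
Proof. by move=> u1 i; rewrite /flip; case: ifP; rewrite ?normrN u1. Qed.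

Definition toggle j A : {set 'I_n} := [set i | (i \in A) (+) (i == j)].

Lemma toggleK j A : toggle j (toggle j A) = A.
Proof. by apply/setP => i; rewrite !inE -addbA addbb addbF. Qed.

Lemma toggleC j l A : toggle j (toggle l A) = toggle l (toggle j A).
Proof. by apply/setP => i; rewrite !inE addbAC. Qed.

Lemma toggle_neq j A : toggle j A <> A.
Proof.
by move/setP => /(_ j); rewrite inE eqxx addbT; case: (j \in A).
Qed.

Lemma toggle_ind (P : {set 'I_n} -> Prop) :
  P finset.set0 -> (forall j A, P A -> P (toggle j A)) -> forall A, P A.
Proof.
move=> P0 Pt A; have [m] := ubnP #|A|; elim: m A => // m IH A.
have [->//|[j jA]] := set_0Vmem A.
rewrite (cardsD1 j) jA ltnS => Am.
have -> : A = toggle j (A :\ j)%SET.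
  by apply/setP => i; rewrite !inE; case: eqVneq => [->|_]; rewrite ?jA ?addbF.
exact/Pt/IH.
Qed.

Definition opposed x y := exists i, `|x i| = 1 /\ y i = - x i.

Definition bits (s : forall i, X i -> bool) x : {set 'I_n} := [set i | s i (x i)].

Lemma odd_signs : exists s : forall i, X i -> bool, forall i, odd_sign (s i).
Proof.
by exists (fun i => projT1 (cid (odd_sign_exists (X i)))) => i; case: cid.
Qed.

Lemma opposed_bits s x y : (forall i, odd_sign (s i)) -> opposed x y ->
  exists i, (i \in bits s x) = (i \notin bits s y).
Proof.
move=> s_odd [i [xi1 yx]]; exists i.
by rewrite !inE yx s_odd// negbK.
Qed.

(** The index type has 2^n elements, as many as there are bit vectors; this is
    the largest size that a family of pairwise opposed points can have. *)
Definition opposed_family (c : {set 'I_n} -> Z) :=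
  forall A B, A <> B -> opposed (c A) (c B).

Lemma opposed_family_bits_onto c s : (forall i, odd_sign (s i)) -> opposed_family c ->
  forall C, exists A, bits s (c A) = C.
Proof.
move=> s_odd c_opp C.
have c_inj : injective (bits s \o c).
  move=> A B /= AB; apply: contrapT => /c_opp /(opposed_bits s_odd)[i].
  by rewrite AB; case: (i \in _).
by have /codomP[A ->] := injF_onto c_inj C; exists A.
Qed.

(** If the i-th coordinate of a member were not a unit vector, its i-th bit could
    be reversed without losing any opposition; but the bit vector so obtained
    already belongs to another member, which is opposed to it. *)
Lemma opposed_family_unit c A i : opposed_family c -> `|c A i| = 1.
Proof.
move=> c_opp; have [s s_odd] := odd_signs.
have [B cB] := opposed_family_bits_onto s_odd c_opp (toggle i (bits s (c A))).
have /c_opp : A <> B by move=> AB; move: cB; rewrite AB => /esym/toggle_neq.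
move=> [j [cAj cBj]]; have : (j \in bits s (c B)) = (j \notin bits s (c A)).
  by rewrite !inE cBj s_odd.
by rewrite cB inE; case: eqVneq => [<-//|_]; case: (j \in _).
Qed.

(** For every choice of signs the bits of y are those of c A or of c B.  If y
    differed from c A in a coordinate i and from c B in a coordinate l <> i, the
    signs in X_i and X_l could be chosen to tell y from both.  So y differs from
    c A and from c B in one and the same coordinate. *)
Lemma opposed_family_neighbours c A B y :
  opposed_family c -> A <> B -> y <> c A -> y <> c B ->
  (forall D, D <> A -> D <> B -> opposed (c D) y) ->
  exists k, c B = flip [set k]%SET (c A).
Proof.
move=> c_opp AB yA yB yD.
have [s0 s0_odd] := odd_signs.
have y_bits s : (forall i, odd_sign (s i)) ->
    bits s y = bits s (c A) \/ bits s y = bits s (c B).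
  move=> s_odd; have [D cD] := opposed_family_bits_onto s_odd c_opp (bits s y).
  have [<-|DA] := pselect (D = A); first by left.
  have [<-|DB] := pselect (D = B); first by right.
  have [i] := opposed_bits s_odd (yD D DA DB).
  by rewrite cD; case: (i \in _).
have one i l : y i <> c A i -> y l <> c B l -> i = l.
  move=> yi yl; apply: contrapT => il.
  have [si si_odd si_sep] :=
    odd_sign_separates (opposed_family_unit A i c_opp) (introN eqP yi).
  have [sl sl_odd sl_sep] :=
    odd_sign_separates (opposed_family_unit B l c_opp) (introN eqP yl).
  pose s : forall i, X i -> bool :=
    eqtype.dfwith (eqtype.dfwith s0 si) sl.
  have s_l : s l = sl by rewrite /s dfwith_in.
  have s_i : s i = si by rewrite /s dfwith_out ?dfwith_in//; apply/eqP => /esym.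
  have s_odd j : odd_sign (s j).
    rewrite /s; have [<-|lj] := eqVneq l j; first by rewrite dfwith_in.
    rewrite dfwith_out//; have [<-|ij] := eqVneq i j; first by rewrite dfwith_in.
    by rewrite dfwith_out.
  have [/setP/(_ i)|/setP/(_ l)] := y_bits _ s_odd; rewrite !inE.
    by rewrite s_i => /eqP; rewrite (negbTE si_sep).
  by rewrite s_l => /eqP; rewrite (negbTE sl_sep).
have diff x : y <> x -> exists i, y i <> x i.
  move=> yx; apply: contrapT => xi; apply/yx/max_sum_ext => i.
  by apply: contrapT => yxi; apply: xi; exists i.
have [k yAk] := diff _ yA; have [l yBl] := diff _ yB.
have kl := one _ _ yAk yBl; subst l.
have off i : i <> k -> c A i = c B i.
  move=> ik; transitivity (y i); apply: contrapT => yi.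
    by apply: ik; apply: one yBl => /esym.
  by apply/ik/esym; apply: one yAk _.
exists k; apply: max_sum_ext => i; rewrite /flip inE.
have [->|ik] := eqVneq i k; last by rewrite off//; apply/eqP.
have [j [cAj cBj]] := c_opp _ _ AB.
have [<-//|jk] := pselect (j = k).
have := unit_neqN cAj; rewrite -cBj -off// eqxx.
by [].
Qed.

End max_sum_theory.

(** * Expansive maps of the unit ball act on unit coordinates *)

Section expansive.
Variables (R : realType) (n : nat) (X : 'I_n -> completeNormedModType R).
Local Notation Z := (max_sum X).
Hypothesis X_strictly_convex : forall i, strictly_convex (X i).
Variable G : Z -> Z.
Hypothesis G_ball : forall x, `|x| <= 1 -> `|G x| <= 1.
Hypothesis G_expansive :
  forall x y, `|x| <= 1 -> `|y| <= 1 -> `|x - y| <= `|G x - G y|.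
Implicit Types (x y z u v w : Z) (A B C D : {set 'I_n}) (i j k l : 'I_n).

Lemma opposed_image u w j : `|u| <= 1 -> `|w| <= 1 -> `|u j| = 1 -> w j = - u j ->
  opposed (G u) (G w).
Proof.
move=> u1 w1 uj wj.
have : 2 <= `|G u - G w|.
  rewrite (le_trans _ (G_expansive u1 w1))// (le_trans _ (coord_norm_le _ j))//.
  have -> : (u - w) j = u j - w j by [].
  by rewrite wj opprK -mulr2n normrMn uj.
move=> d2.
have d0 : 0 < `|G u - G w| by apply: lt_le_trans d2.
have [i di] := max_sum_norm_attained d0.
have Gi z : `|z| <= 1 -> `|G z i| <= 1.
  by move=> z1; rewrite (le_trans (coord_norm_le _ i))// G_ball.
rewrite -di in d2.
have [] := antipodal_of_dist2 (@X_strictly_convex i) (Gi _ u1) (Gi _ w1) d2.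
by exists i.
Qed.

Lemma expansive_inj x y : `|x| <= 1 -> `|y| <= 1 -> G x = G y -> x = y.
Proof.
move=> x1 y1 Gxy; apply/eqP; rewrite -subr_eq0 -normr_le0.
by rewrite (le_trans (G_expansive x1 y1))// Gxy subrr normr0.
Qed.

Lemma opposed_image_flip u A w : unit_coords u -> `|w| <= 1 ->
  (exists j, w j = if j \in A then u j else - u j) -> opposed (G (flip A u)) (G w).
Proof.
move=> u1 w1 [j wj]; apply: (opposed_image (j := j)) => //.
- exact/unit_coords_ball/unit_coords_flip.
- exact: unit_coords_flip.
- by rewrite wj /flip; case: ifP; rewrite ?opprK.
Qed.

Lemma opposed_family_image u : unit_coords u -> opposed_family (fun A => G (flip A u)).
Proof.
move=> u1 A B AB; apply: opposed_image_flip => //.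
  exact/unit_coords_ball/unit_coords_flip.
have [j jAB] : exists j, (j \in A) != (j \in B).
  apply: contrapT => AB'; apply: AB; apply/setP => j; apply/eqP.
  by apply: contrapT => /negP jAB; apply: AB'; exists j.
exists j; move: jAB; rewrite /flip.
by case: (j \in A); case: (j \in B); rewrite ?opprK.
Qed.

Lemma unit_coords_image u : unit_coords u -> unit_coords (G u).
Proof.
move=> u1 i;
have := opposed_family_unit finset.set0 i (opposed_family_image u1).
by congr (`| G _ i| = 1); apply: max_sum_ext => j; rewrite /flip inE.
Qed.

(** Replacing the j-th coordinate of [flip A u] by 0 gives a point w that is
    still opposed to all sign changes of u other than [flip A u] and its j-th
    neighbour; G w is the point to which [opposed_family_neighbours] applies. *)
Lemma image_flip_neighbour u j A : unit_coords u ->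
  exists k, G (flip (toggle j A) u) = flip [set k]%SET (G (flip A u)).
Proof.
move=> u1; pose w : Z := eqtype.dfwith (flip A u) (0 : X j).
have wj : w j = 0 by rewrite /w dfwith_in.
have wi i : i <> j -> w i = flip A u i.
  by move=> /eqP; rewrite eq_sym => ij; rewrite /w dfwith_out.
have fb B : `|flip B u| <= 1 by exact/unit_coords_ball/unit_coords_flip.
have w1 : `|w| <= 1.
  apply: max_sum_norm_le => // i; have [->|/eqP ij] := eqVneq i j.
    by rewrite wj normr0.
  by rewrite wi//; rewrite (le_trans (coord_norm_le _ i)).
have wB B : G w <> G (flip B u).
  move=> /expansive_inj -/(_ w1 (fb B)) wB.
  have := unit_coords_flip B u1 j; rewrite -wB wj normr0 => /esym/eqP.
  by rewrite oner_eq0.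
apply: (opposed_family_neighbours (c := fun A => G (flip A u)) (y := G w)) => //.
- exact: opposed_family_image.
- by move=> /esym/toggle_neq.
move=> D DA DA'; apply: opposed_image_flip => //.
have [i [ij iD]] : exists i, i <> j /\ (i \in D) != (i \in A).
  apply: contrapT => ni.
  have DAi i : i <> j -> (i \in D) = (i \in A).
    move=> ij; apply/eqP; apply: contrapT => /negP iDA.
    by apply: ni; exists i.
  have [jDA|jDA] := eqVneq (j \in D) (j \in A).
    apply: DA; apply/setP => i; have [->//|/eqP] := eqVneq i j; exact: DAi.
  apply: DA'; apply/setP => i; rewrite inE.
  have [->|/eqP ij] := eqVneq i j; last by rewrite addbF DAi.
  by move: jDA; case: (j \in D); case: (j \in A).
exists i; rewrite wi// /flip; move: iD.
by case: (i \in D); case: (i \in A); rewrite ?opprK.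
Qed.

(** Let q A j be the coordinate whose sign changes in G (flip A u) when that of
    the j-th coordinate changes in [flip A u].  Going around a square of the cube
    in both ways shows that q A j is the same at all vertices A. *)
Lemma image_flip u : unit_coords u -> exists2 p : 'I_n -> 'I_n, injective p &
  forall A j, G (flip A u) (p j) = if j \in A then - G u (p j) else G u (p j).
Proof.
move=> u1.
pose c A := G (flip A u).
have c1 A i : `|c A i| = 1 by exact/unit_coords_image/unit_coords_flip.
have c_inj A B : c A = c B -> A = B.
  move=> cAB; apply: contrapT => /(opposed_family_image u1)[i []].
  rewrite -/(c A) -/(c B) -cAB => ci /eqP; rewrite unit_neqN//.
have [q qE] : exists q, forall A j, c (toggle j A) = flip [set q A j]%SET (c A).
  exists (fun A j => projT1 (cid (image_flip_neighbour j A u1))) => A j.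
  by case: cid.
have flipE k x i : flip [set k]%SET x i = if i == k then - x i else x i.
  by rewrite /flip inE.
have cN A i : (c A i == - c A i) = false by exact: unit_neqN (c1 A i).
have q_inj A : injective (q A).
  move=> j l qjl.
  have /c_inj/setP/(_ j) : c (toggle j A) = c (toggle l A) by rewrite !qE qjl.
  by rewrite !inE eqxx; case: eqVneq => //; case: (j \in A).
have q_back A j : q (toggle j A) j = q A j.
  have := congr1 (fun x : Z => x (q A j)) (qE (toggle j A) j).
  rewrite toggleK qE !flipE eqxx; case: eqVneq => // _ /eqP.
  by rewrite cN.
have q_toggle A j l : q (toggle l A) j = q A j.
  have [<-//|jl] := eqVneq j l.
  have := congr1 (fun x : Z => x (q A j)) (qE (toggle l A) j).
  rewrite toggleC !qE !flipE eqxx (inj_eq (@q_inj A)) (negbTE jl).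
  have -> : (q A j == q (toggle j A) l) = false.
    by rewrite -q_back (inj_eq (@q_inj _)) (negbTE jl).
  by case: eqVneq => // _ /eqP; rewrite eq_sym cN.
have q0 A j : q A j = q finset.set0 j.
  by elim/toggle_ind: A => // l A; rewrite q_toggle.
have c0 : c finset.set0 = G u.
  by congr G; apply: max_sum_ext => i; rewrite /flip inE.
exists (q finset.set0); first exact: q_inj.
move=> A j; rewrite -c0; elim/toggle_ind: A => [|l A IH]; first by rewrite inE.
rewrite -/(c (toggle l A)) qE flipE q0 (inj_eq (@q_inj _)) -/(c A) in IH *.
rewrite IH inE; case: eqVneq => [->|]; last by rewrite addbF.
by case: (l \in A); rewrite //= opprK.
Qed.

(** Among the vertices [flip A u] on the side of the cube opposite to w j, there
    is one whose image is not opposed to G w in any coordinate other than p j; so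
    it is opposed to it in the coordinate p j. *)
Lemma unit_coord_image u p (b : bool) w j : unit_coords u -> injective p ->
  (forall A i, G (flip A u) (p i) = if i \in A then - G u (p i) else G u (p i)) ->
  `|w| <= 1 -> w j = (if b then - u j else u j) ->
  G w (p j) = if b then - G u (p j) else G u (p j).
Proof.
move=> u1 p_inj pE w1 wj; have Gu1 := unit_coords_image u1.
(* Away from p j, the signs make G (flip A u) avoid the negative of G w. *)
pose A := [set i | if i == j then ~~ b else G w (p i) == - G u (p i)]%SET.
have [i [_]] : opposed (G (flip A u)) (G w).
  apply: opposed_image_flip => //; exists j.
  by rewrite inE eqxx wj; case: (b).
have [k ->] := inj_surj p_inj i; rewrite pE inE.
have [->|kj] := eqVneq k j; first by case: (b); rewrite ?opprK.
case: eqVneq => [->|/eqP//]; rewrite opprK => /esym/eqP.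
by rewrite (unit_neqN (Gu1 _)).
Qed.

Hypothesis X_nontrivial : forall i, exists x : X i, x != 0.

(** The map h j is read off from the points that agree with a fixed u off the
    coordinate j.  Two base points that differ only there have permutations that
    agree off j, hence agree. *)
Lemma expansive_unit_coords : exists2 p : 'I_n -> 'I_n, injective p &
  exists h : forall j, X j -> X (p j),
  [/\ forall w j, `|w| <= 1 -> `|w j| = 1 -> G w (p j) = h j (w j),
      forall j a, `|a| = 1 -> `|h j a| = 1 /\ h j (- a) = - h j a
    & forall j a b, `|a| = 1 -> `|b| = 1 -> h j a = h j b -> a = b].
Proof.
have [u u1] := unit_coords_exists X_nontrivial.
have [p p_inj pE] := image_flip u1.
pose up j (a : X j) : Z := eqtype.dfwith u a.
have upj j a : @up j a j = a by rewrite /up dfwith_in.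
have upi j a i : i <> j -> @up j a i = u i.
  by move=> ij; rewrite /up dfwith_out//; apply/eqP => /esym.
have up1 j a : `|a| = 1 -> unit_coords (@up j a).
  move=> a1 i; have [->|/eqP ij] := eqVneq i j; first by rewrite upj.
  by rewrite upi.
have pup j a : `|a| = 1 -> forall A i, G (flip A (@up j a)) (p i) =
    if i \in A then - G (@up j a) (p i) else G (@up j a) (p i).
  move=> a1; have v1 := up1 _ _ a1; have [q q_inj qE] := image_flip v1.
  suff pq i : i <> j -> p i = q i.
    have pqj : p j = q j.
      have [l pjl] := inj_surj q_inj (p j); rewrite pjl.
      have [->//|/eqP lj] := eqVneq l j.
      by move: pjl; rewrite -pq// => /p_inj/esym.
    move=> A i; have [->|/eqP ij] := eqVneq i j; first by rewrite pqj.
    by rewrite pq.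
  move=> ij; have [l pil] := inj_surj q_inj (p i); rewrite pil.
  have b1 := unit_coords_ball v1.
  have H1 := unit_coord_image (b := false) u1 p_inj pE b1 (upi _ _ _ ij).
  have f1 := unit_coords_ball (unit_coords_flip [set i]%SET v1).
  have : flip [set i]%SET (@up j a) i = - u i by rewrite /flip inE eqxx upi.
  move=> /(unit_coord_image (b := true) u1 p_inj pE f1).
  rewrite -H1 pil qE inE; case: eqVneq => [->//|_] /eqP.
  by rewrite (unit_neqN (unit_coords_image v1 _)).
exists p => //; exists (fun j a => G (@up j a) (p j)).
have key w j : `|w| <= 1 -> `|w j| = 1 -> G w (p j) = G (@up j (w j)) (p j).
  move=> w1 wj; apply: (unit_coord_image (b := false) (up1 _ _ wj) p_inj) => //.
  exact: pup.
split=> // j a.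
  move=> a1; split; first exact: unit_coords_image (up1 _ _ a1) _.
  have Na1 : `|- a| = 1 by rewrite normrN.
  apply: (unit_coord_image (b := true) (up1 _ _ a1) p_inj) => //; rewrite ?upj//.
    exact: pup.
  exact/unit_coords_ball/up1.
move=> b a1 b1 hab; rewrite -[a]upj -[b](upj j).
congr ((_ : Z) j).
apply: expansive_inj; [exact/unit_coords_ball/up1|exact/unit_coords_ball/up1|].
apply: max_sum_ext => k; have [i ->] := inj_surj p_inj k.
have [->//|/eqP ij] := eqVneq i j.
have ub c : `|c| = 1 -> G (@up j c) (p i) = G u (p i).
  move=> c1; apply: (unit_coord_image (b := false) u1 p_inj pE).
    exact/unit_coords_ball/up1.
  exact: upi.
by rewrite !ub.
Qed.

End expansive.

(** * From unit coordinates to the whole ball *)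

Section nonexpansive_bijection.
Variables (R : realType) (n : nat) (X : 'I_n -> completeNormedModType R).
Local Notation Z := (max_sum X).
Implicit Types (x y z u v w : Z) (i j k l : 'I_n).
Hypothesis X_nontrivial : forall i, exists x : X i, x != 0.
Hypothesis X_strictly_convex : forall i, strictly_convex (X i).
Variables f G : Z -> Z.
Hypothesis f_ball : forall x, `|x| <= 1 -> `|f x| <= 1.
Hypothesis f_lip : forall x y, `|x| <= 1 -> `|y| <= 1 -> `|f x - f y| <= `|x - y|.
Hypothesis G_ball : forall w, `|w| <= 1 -> `|G w| <= 1.
Hypothesis fK : forall x, `|x| <= 1 -> G (f x) = x.
Hypothesis GK : forall w, `|w| <= 1 -> f (G w) = w.
Variables (p : 'I_n -> 'I_n) (h : forall j, X j -> X (p j)).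
Hypothesis p_inj : injective p.
Hypothesis G_unit : forall w j, `|w| <= 1 -> `|w j| = 1 -> G w (p j) = h (w j).
Hypothesis h_unit : forall j (a : X j), `|a| = 1 -> `|h a| = 1 /\ h (- a) = - h a.
Hypothesis h_inj : forall j (a b : X j), `|a| = 1 -> `|b| = 1 -> h a = h b -> a = b.

(** The positively homogeneous extension of h to the whole space. *)
Definition radial j (z : X j) : X (p j) := `|z| *: h (`|z|^-1 *: z).

Lemma polar j (z : X j) : exists2 a : X j, `|a| = 1 & z = `|z| *: a.
Proof.
have [->|z0] := eqVneq z 0.
  by have [a a1] := unit_vector (X_nontrivial j); exists a; rewrite ?normr0 ?scale0r.
exists (`|z|^-1 *: z).
  by rewrite normrZ normfV normr_id mulVf// normr_eq0.
by rewrite scalerA divff ?scale1r// normr_eq0.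
Qed.

Lemma radialZ j (t : R) (a : X j) : `|a| = 1 -> radial (t *: a) = t *: h a.
Proof.
move=> a1; rewrite /radial normrZ a1 mulr1 scalerA.
have [->|t0] := eqVneq t 0; first by rewrite normr0 !scale0r.
have [tp|tn] := ltrP 0 t; first by rewrite gtr0_norm// mulVf// scale1r.
rewrite ler0_norm// invrN mulNr mulVf// scaleN1r.
by have [_ ->] := h_unit a1; rewrite scalerN scaleNr opprK.
Qed.

Lemma radial_unit j (a : X j) : `|a| = 1 -> radial a = h a.
Proof. by move=> a1; rewrite -[a in LHS]scale1r radialZ// scale1r. Qed.

Lemma radial_scale j (t : R) (z : X j) : radial (t *: z) = t *: radial z.
Proof.
by have [a a1 ->] := polar z; rewrite scalerA !radialZ// scalerA.
Qed.

Lemma radial_norm j (z : X j) : `|radial z| = `|z|.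
Proof.
have [a a1 ->] := polar z; rewrite radialZ// !normrZ a1.
by have [-> _] := h_unit a1.
Qed.

Lemma radial_inj j : injective (@radial j).
Proof.
move=> z z' zz'; have nzz' : `|z| = `|z'| by rewrite -(radial_norm z) zz' radial_norm.
have [z0|z0] := eqVneq `|z| 0.
  move: nzz'; rewrite z0 => /esym/eqP; rewrite normr_eq0 => /eqP ->.
  by apply/eqP; rewrite -normr_eq0 z0.
move: zz'; have [a a1 ->] := polar z; have [a' a1' ->] := polar z'.
rewrite !radialZ// -nzz' => /(scalerI z0)/h_inj -> //.
Qed.

(** As p is a permutation, a point can be prescribed by its coordinates p j.
    Equality in the total space of X absorbs the transport along k = p j. *)
Lemma radial_lift w : exists x : Z, forall j, x (p j) = radial (w j).
Proof.
have lift k : exists a : X k, forall j, k = p j ->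
    Tagged X a = Tagged X (radial (w j)).
  have [l ->] := inj_surj p_inj k; exists (radial (w l)) => j /p_inj ->.
  by [].
exists (fun k => projT1 (cid (lift k))) => j; case: cid => a /= aE.
have := aE j erefl; move/eqP; rewrite -tag_eqE /tag_eq eqxx/= tagged_asE.
by move/eqP.
Qed.

Lemma radial_ball x w : (forall j, x (p j) = radial (w j)) -> `|w| <= 1 -> `|x| <= 1.
Proof.
move=> xw w1; apply: max_sum_norm_le => // k; have [j ->] := inj_surj p_inj k.
by rewrite xw radial_norm (le_trans (coord_norm_le _ _)).
Qed.

(** The two modifications of x lie at distances at most 1 - t and 1 + t from x,
    and so do their images from f x; in the coordinate j this is the situation of
    [between_antipodes]. *)
Lemma between_image x j (a : X j) (t : R) : `|x| <= 1 -> `|a| = 1 -> 0 <= t <= 1 ->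
  x (p j) = t *: h a ->
  f (eqtype.dfwith x (h a)) j = a -> f (eqtype.dfwith x (- h a)) j = - a ->
  f x j = t *: a.
Proof.
move=> x1 a1 /andP[t0 t1] xa fa fNa; have [ha1 _] := h_unit a1.
have upd (b : X (p j)) (r : R) : `|b| = 1 -> `|x (p j) - b| <= r ->
    `|f x j - f (eqtype.dfwith x b) j| <= r.
  move=> b1 xb; have r0 : 0 <= r by apply: le_trans xb.
  have y1 : `|eqtype.dfwith x b : Z| <= 1 by rewrite update_ball ?b1.
  rewrite (le_trans (coord_norm_le (f x - f _) j))// (le_trans (f_lip x1 y1))//.
  apply: max_sum_norm_le => // i.
  have -> : (x - (eqtype.dfwith x b : Z)) i = x i - eqtype.dfwith x b i by [].
  have [<-|ji] := eqVneq (p j) i; first by rewrite dfwith_in.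
  by rewrite dfwith_out// subrr normr0.
apply: (between_antipodes (@X_strictly_convex j)) => //; first by rewrite t0.
- have := upd (h a) (1 - t) ha1; rewrite fa; apply.
  rewrite xa -[X in _ - X]scale1r -scalerBl normrZ ha1 mulr1 distrC ger0_norm//.
  by rewrite subr_ge0.
- have := upd (- h a) (1 + t); rewrite fNa !opprK normrN; apply => //.
  rewrite xa -[X in _ + X]scale1r -scalerDl normrZ ha1 mulr1 ger0_norm//.
    by rewrite addrC.
  by rewrite addr_ge0.
Qed.

Lemma isometry_of_radial :
  (forall w j, `|w| <= 1 -> G w (p j) = radial (w j)) ->
  forall x y, `|x| <= 1 -> `|y| <= 1 -> `|f x - f y| = `|x - y|.
Proof.
move=> Gw; have xE x j : `|x| <= 1 -> x (p j) = radial (f x j).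
  by move=> x1; rewrite -[x in LHS]fK// Gw// f_ball.
apply: isometry_of_homogeneous => [x x1|t x t1 x1|]; last exact: f_lip.
- apply/eqP; rewrite eq_le; apply/andP; split; apply: max_sum_norm_le => // i.
    by rewrite -radial_norm -xE// coord_norm_le.
  by have [j ->] := inj_surj p_inj i; rewrite xE// radial_norm coord_norm_le.
- have tx1 : `|t *: x| <= 1 by rewrite normrZ mulr_ile1.
  apply: max_sum_ext => j; apply: radial_inj; rewrite -xE//.
  have -> : (t *: f x) j = t *: f x j by [].
  by rewrite radial_scale -xE.
Qed.

(** Shrink all coordinates of x other than p j by the factor 1 - e.  The new
    point y is on the sphere, hence so is f y, and a coordinate of f y of norm 1
    comes from one of y, which can only be the coordinate p j.  So f y j = a;
    now let e tend to 0. *)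
Lemma sphere_unit_coord x j (a : X j) : (forall z, `|z| = 1 -> `|f z| = 1) ->
  `|x| <= 1 -> `|a| = 1 -> x (p j) = h a -> f x j = a.
Proof.
move=> f_sphere x1 a1 xa; have [ha1 _] := h_unit a1.
have close (e : R) : 0 < e < 1 -> `|f x j - a| <= e.
  move=> /andP[e0 e1]; pose y : Z := eqtype.dfwith ((1 - e) *: x) (h a).
  have yj : y (p j) = h a by rewrite /y dfwith_in.
  have yi i : p j != i -> y i = (1 - e) *: x i by move=> ji; rewrite /y dfwith_out.
  have xi i : `|x i| <= 1 by rewrite (le_trans (coord_norm_le _ _)).
  have yi1 i : p j != i -> `|y i| < 1.
    move=> ji; rewrite yi// normrZ gtr0_norm ?subr_gt0//.
    apply: (@le_lt_trans _ _ (1 - e)); last by rewrite ltrBlDr ltrDl.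
    by apply: ler_piMr; [rewrite subr_ge0 ltW|exact: xi].
  have y1 : `|y| = 1.
    apply/eqP; rewrite eq_le; apply/andP; split; last first.
      by rewrite -ha1 -yj coord_norm_le.
    apply: max_sum_norm_le => // i; have [<-|ji] := eqVneq (p j) i.
      by rewrite yj ha1.
    exact/ltW/yi1.
  have fya : f y j = a.
    have fy1 := f_sphere _ y1.
    have [i fyi] : exists i, `|f y i| = `|f y|.
      by apply: max_sum_norm_attained; rewrite fy1.
    rewrite fy1 in fyi.
    have yh : y (p i) = h (f y i).
      by rewrite -[y in LHS]fK ?y1// G_unit ?f_ball ?y1.
    have [pji|pji] := eqVneq (p j) (p i).
      have ji := p_inj pji; subst i.
      by apply: h_inj => //; rewrite -yh yj.
    have := yi1 _ pji; rewrite yh; have [-> _] := h_unit fyi.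
    by rewrite ltxx.
  rewrite -fya; apply: le_trans (coord_norm_le (f x - f y) j) _.
  rewrite (le_trans (f_lip x1 _)) ?y1//; apply: max_sum_norm_le; first exact: ltW.
  move=> i; have -> : (x - y) i = x i - y i by [].
  have [<-|ji] := eqVneq (p j) i; first by rewrite xa yj subrr normr0 ltW.
  rewrite yi// scalerBl scale1r opprB addrCA subrr addr0 normrZ gtr0_norm//.
  by apply: ler_piMr; [exact: ltW|exact: xi].
apply/eqP; rewrite -subr_eq0 -normr_le0 leNgt; apply/negP => d0.
have fx1 : `|f x j| <= 1 by rewrite (le_trans (coord_norm_le _ _))// f_ball.
have := close (`|f x j - a| / 3); have := ler_normB (f x j) a.
lra.
Qed.

Lemma radial_of_sphere : (forall z, `|z| = 1 -> `|f z| = 1) ->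
  forall w j, `|w| <= 1 -> G w (p j) = radial (w j).
Proof.
move=> f_sphere w j w1; have [x xw] := radial_lift w.
have x1 := radial_ball xw w1.
suff fx : f x = w by rewrite -fx fK// fx.
apply: max_sum_ext => i; have [a a1 wa] := polar (w i).
have [ha1 hN] := h_unit a1.
rewrite wa; apply: between_image => //.
- by rewrite normr_ge0 (le_trans (coord_norm_le _ _)).
- by rewrite xw [in LHS]wa radialZ.
- apply: sphere_unit_coord => //; last by rewrite dfwith_in.
  by rewrite update_ball ?ha1.
- apply: sphere_unit_coord => //; rewrite ?normrN ?dfwith_in//.
  by rewrite update_ball ?normrN ?ha1.
Qed.

Lemma radial_onto : (forall u, unit_coords u -> unit_coords (f u)) ->
  forall j (b : X (p j)), exists a, radial a = b.
Proof.
move=> f_ext j b; have [b' b'1 ->] := polar b.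
have [u u1] := unit_coords_exists X_nontrivial.
pose v : Z := eqtype.dfwith u b'.
have v1 : unit_coords v.
  by move=> i; rewrite /v; have [<-|ji] := eqVneq (p j) i; rewrite ?dfwith_in ?dfwith_out.
have fv1 := f_ext _ v1.
exists (`|b| *: f v j); rewrite radialZ//; congr (_ *: _).
by rewrite -G_unit ?f_ball ?unit_coords_ball// fK ?unit_coords_ball// /v dfwith_in.
Qed.

Definition nonunit w : {set 'I_n} := [set j | `|w j| != 1].

(** Let w' be the point whose radial image is G w.  It has at least as many unit
    coordinates as w.  If it has more, induction gives G w' = G w.  If not, a
    coordinate of w' that is not a unit vector can be raised to one, induction
    computes G at the points so obtained, and [between_image] shows that w and w'
    agree in that coordinate. *)
Lemma radial_of_extreme : (forall u, unit_coords u -> unit_coords (f u)) ->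
  forall w j, `|w| <= 1 -> G w (p j) = radial (w j).
Proof.
move=> f_ext w j w1; have [m] := ubnP #|nonunit w|; elim: m => // m IH in w j w1 *.
rewrite ltnS => wm.
have [w' w'E] : exists w', forall i, radial (w' i) = G w (p i).
  exists (fun i => projT1 (cid (radial_onto f_ext (G w (p i))))) => i.
  by case: cid.
have w'1 : `|w'| <= 1.
  apply: max_sum_norm_le => // i; rewrite -radial_norm w'E.
  by rewrite (le_trans (coord_norm_le _ _))// G_ball.
have sub : nonunit w' \subset nonunit w.
  apply/fintype.subsetP => i; rewrite !inE; apply: contra => /eqP wi.
  by rewrite -radial_norm w'E G_unit//; have [-> _] := h_unit wi.
have [eqN|neqN] := eqVneq (nonunit w') (nonunit w); last first.
  have lt : (#|nonunit w'| < m)%N.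
    by apply: leq_trans wm; apply: proper_card; rewrite finset.properEneq neqN.
  suff ww' : w = w' by rewrite -w'E -ww'.
  rewrite -(GK w1) -(GK w'1); congr f; apply: max_sum_ext => k.
  by have [i ->] := inj_surj p_inj k; rewrite (IH w').
have [wj1|wj1] := eqVneq `|w j| 1; first by rewrite G_unit// radial_unit.
have jN : j \in nonunit w' by rewrite eqN inE.
have [a a1 w'a] := polar (w' j); have [ha1 hN] := h_unit a1.
have raise (b : X j) : `|b| = 1 -> f (eqtype.dfwith (G w) (h b)) j = b.
  move=> b1; pose v : Z := eqtype.dfwith w' b.
  have vj : v j = b by rewrite /v dfwith_in.
  have vi i : i != j -> v i = w' i.
    by rewrite eq_sym => ij; rewrite /v dfwith_out.
  have v1 : `|v| <= 1 by rewrite update_ball ?b1.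
  have lt : (#|nonunit v| < m)%N.
    apply: leq_trans wm; rewrite -eqN; apply: proper_card; apply/properP; split.
      apply/fintype.subsetP => i; rewrite !inE; have [->|ij] := eqVneq i j.
        by rewrite vj b1 eqxx.
      by rewrite vi.
    by exists j => //; rewrite inE vj b1 eqxx.
  have -> : eqtype.dfwith (G w) (h b) = G v.
    apply: max_sum_ext => k; have [i ->] := inj_surj p_inj k; rewrite IH//.
    have [->|ij] := eqVneq i j; first by rewrite dfwith_in vj radial_unit.
    by rewrite dfwith_out ?vi// (inj_eq p_inj) eq_sym.
  by rewrite GK.
suff wj : f (G w) j = w' j by rewrite -w'E -wj GK.
rewrite w'a; apply: between_image => //; first exact: G_ball.
- by rewrite normr_ge0 (le_trans (coord_norm_le _ _)).
- by rewrite -w'E [in LHS]w'a radialZ.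
- exact: raise.
- by rewrite -hN raise ?normrN.
Qed.

End nonexpansive_bijection.

(** * Extreme points of the unit ball, and the theorem *)

Section extreme_points.
Variables (R : realType) (n : nat) (X : 'I_n -> completeNormedModType R).
Local Notation Z := (max_sum X).

Lemma closed_unit_ballE (V : normedModType R) (x : V) :
  closed_ball 0 1 x = (`|x| <= 1) :> Prop.
Proof. by rewrite closed_ballE// /closed_ball_/= sub0r normrN. Qed.

Lemma extreme_of_unit_coords (u : Z) : (forall i, strictly_convex (X i)) ->
  unit_coords u -> extreme_point (closed_ball (0 : Z) 1) u.
Proof.
move=> X_sc u1; split; first by rewrite closed_unit_ballE unit_coords_ball.
move=> y z; rewrite !closed_unit_ballE => y1 z1 [t + ut].
rewrite /= in_itv/= => t01.
have yz : y = z.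
  apply: max_sum_ext => i; apply: (strictly_convex_eq (@X_sc i) _ _ t01).
  - by rewrite (le_trans (coord_norm_le _ _)).
  - by rewrite (le_trans (coord_norm_le _ _)).
  - by have := u1 i; rewrite -ut.
by move: ut; rewrite yz -scalerDl subrK scale1r.
Qed.

Lemma unit_coords_of_extreme (u : Z) : (forall i, exists x : X i, x != 0) ->
  extreme_point (closed_ball (0 : Z) 1) u -> unit_coords u.
Proof.
move=> X_nt [+ u_ext] i; rewrite closed_unit_ballE => u1.
apply/eqP; rewrite eq_le (le_trans (coord_norm_le _ _))//= leNgt; apply/negP => ui.
have [a a1] := unit_vector (X_nt i).
pose b := (1 - `|u i|) *: a.
have b1 : `|b| = 1 - `|u i| by rewrite normrZ a1 mulr1 gtr0_norm// subr_gt0.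
pose y : Z := eqtype.dfwith u (u i - b); pose z : Z := eqtype.dfwith u (u i + b).
have y1 : closed_ball (0 : Z) 1 y.
  rewrite closed_unit_ballE update_ball// (le_trans (ler_normB _ _))// b1.
  by rewrite addrC subrK.
have z1 : closed_ball (0 : Z) 1 z.
  rewrite closed_unit_ballE update_ball// (le_trans (ler_normD _ _))// b1.
  by rewrite addrC subrK.
have [|_ zu] := u_ext y z y1 z1.
  exists 2^-1; first by rewrite /= in_itv/=; lra.
  have -> : 1 - 2^-1 = 2^-1 :> R by lra.
  rewrite -scalerDr; apply: max_sum_ext => k.
  have -> : (2^-1 *: (y + z)) k = 2^-1 *: (y k + z k) by [].
  have -> : y k + z k = 2 *: u k.
    rewrite scaler_nat mulr2n /y /z; have [<-|ik] := eqVneq i k.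
      by rewrite !dfwith_in addrACA addNr addr0.
    by rewrite !dfwith_out.
  by rewrite scalerA mulVf ?scale1r.
have : z i = u i by rewrite zu.
rewrite /z dfwith_in => /eqP; rewrite -subr_eq0 addrC addKr -normr_eq0 b1.
by rewrite subr_eq0 => /eqP ui1; move: ui; rewrite -ui1 ltxx.
Qed.

End extreme_points.

Theorem theorem4p3 (R : realType) (n : nat) (n_ge1 : (1 <= n)%N)
    (X : 'I_n -> completeNormedModType R)
    (X_nontrivial : forall i, exists x : X i, x != 0)
    (X_strictly_convex : forall i, strictly_convex (X i))
    (Z := max_sum X) (BZ := closed_ball (0 : Z) 1) (SZ := unit_sphere Z)
    (f : Z -> Z)
    (f_bij : set_bij BZ BZ f)
    (f_lip : 1.-lipschitz_BZ f)
    (f_ext_or_sphere :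
      (forall x, extreme_point BZ x -> extreme_point BZ (f x)) \/
      f @` SZ `<=` SZ) :
  isometry_on BZ f.
Proof.
have BE (x : Z) : BZ x = (`|x| <= 1) :> Prop by exact: closed_unit_ballE.
have [f_fun f_inj f_surj] := f_bij.
have f_ball x : `|x| <= 1 -> `|f x| <= 1 by rewrite -!BE; apply: f_fun.
have f_lip1 x y : `|x| <= 1 -> `|y| <= 1 -> `|f x - f y| <= `|x - y|.
  by rewrite -!BE => x1 y1; have := f_lip (x, y) (conj x1 y1); rewrite /= mul1r.
have [G GP] : exists G : Z -> Z, forall w, `|w| <= 1 -> `|G w| <= 1 /\ f (G w) = w.
  have Gw w : exists x, `|w| <= 1 -> `|x| <= 1 /\ f x = w.
    have [w1|w1] := pselect (`|w| <= 1); last by exists 0.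
    move: (w1); rewrite -BE => /f_surj[x]; rewrite BE => x1 fx.
    by exists x.
  by exists (fun w => projT1 (cid (Gw w))) => w; case: cid.
have G_ball w : `|w| <= 1 -> `|G w| <= 1 by move=> /GP[].
have GK w : `|w| <= 1 -> f (G w) = w by move=> /GP[].
have fK x : `|x| <= 1 -> G (f x) = x.
  by move=> x1; apply: f_inj; rewrite ?inE ?BE ?GK ?G_ball ?f_ball.
have G_exp x y : `|x| <= 1 -> `|y| <= 1 -> `|x - y| <= `|G x - G y|.
  by move=> x1 y1; rewrite -[in leLHS](GK x)// -[in leLHS](GK y)// f_lip1 ?G_ball.
have [p p_inj [h [G_unit h_unit h_inj]]] :=
  expansive_unit_coords X_strictly_convex G_ball G_exp X_nontrivial.
have Gw w j : `|w| <= 1 -> G w (p j) = radial (@h) (w j).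
  case: f_ext_or_sphere => [f_ext|f_sphere].
    apply: (radial_of_extreme X_nontrivial X_strictly_convex f_ball f_lip1
      G_ball fK GK p_inj G_unit h_unit) => // u u1.
    apply: unit_coords_of_extreme => //; apply: f_ext.
    exact: extreme_of_unit_coords.
  apply: (radial_of_sphere X_nontrivial X_strictly_convex f_ball f_lip1
    fK p_inj G_unit h_unit h_inj) => z z1.
  by apply: f_sphere; exists z.
move=> x y; rewrite !inE !BE.
exact: (isometry_of_radial X_nontrivial f_ball f_lip1 fK p_inj h_unit h_inj Gw).
Qed.
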